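(* Let $E_1$ and $E_2$ be (disjoint) finite sets and let $f:E_1\to E_2$ be a function. Let $\mathscr{C}_{f^{-1}}$ be the matroid on $E_1\sqcup E_2$ with rank function $$\mathrm{rk}_{\mathscr{C}_{f^{-1}}}(S\sqcup T)=|f(S)\cup T|,\qquad S\subseteq E_1,\ T\subseteq E_2.$$ Then $\mathscr{C}_{f^{-1}*}(N)=f^{-1}(N)$ for every matroid $N$ on $E_2$.
   Context: All matroids are on finite ground sets. For a function $f:E_1\to E_2$ of finite sets and a matroid $N$ on $E_2$, the pullback matroid $f^{-1}(N)$ is the matroid on $E_1$ with rank function $\mathrm{rk}_{f^{-1}(N)}(S)=\mathrm{rk}_N(f(S))$ for $S\subseteq E_1$. For matroids $M,N$ on the same ground set, the intersection $M\wedge N$ is the matroid whose bases are the inclusion-minimal sets among $\{B\cap B' : B \text{ a basis of } M,\ B'\text{ a basis of } N\}$. $\mathbf{B}_{E}$ is the Boolean matroid on $E$ (only basis $E$). Here the correspondence goes from matroids on $E_2$ to matroids on $E_1$: for a matroid $\mathscr{C}$ on $E_1\sqcup E_2$ and a matroid $N$ on $E_2$, $\mathscr{C}_*(N):=\big((\mathbf{B}_{E_1}\oplus N)\wedge \mathscr{C}\big)\setminus E_2$. *)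

(* Defs.v *)
From HB Require Import structures.
From mathcomp Require Import all_boot.
From mathcomp Require Import zify.

Set Implicit Arguments.
Unset Strict Implicit.
Unset Printing Implicit Defensive.

(** Matroids on a finite type, given by their bases.  Since the basis axioms are
    boolean, two matroids are (Leibniz) equal as soon as they have the same
    bases. *)

Definition basis_axioms (E : finType) (BB : {set {set E}}) : bool :=
  (BB != set0) &&
  [forall A in BB, forall B in BB, forall x in A :\: B,
     exists y in B :\: A, (y |: (A :\ x)) \in BB].

Record matroid (E : finType) :=
  Matroid { bases : {set {set E}}; basesP : basis_axioms bases }.

HB.instance Definition _ (E : finType) := [isSub for @bases E].
HB.instance Definition _ (E : finType) := [Equality of matroid E by <:].

Definition indep (E : finType) (M : matroid E) (I : {set E}) : bool :=
  [exists B in bases M, I \subset B].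

Definition rank (E : finType) (M : matroid E) (S : {set E}) : nat :=
  \max_(B in bases M) #|B :&: S|.

Definition indep_axioms (E : finType) (P : pred {set E}) : Prop :=
  [/\ P set0,
      forall I J : {set E}, I \subset J -> P J -> P I
    & forall I J : {set E}, P I -> P J -> #|I| < #|J| ->
        exists2 x, x \in J :\: I & P (x |: I)].

Definition rank_axioms (E : finType) (r : {set E} -> nat) : Prop :=
  [/\ forall S, r S <= #|S|,
      forall S T : {set E}, S \subset T -> r S <= r T
    & forall S T, r (S :|: T) + r (S :&: T) <= r S + r T].

Lemma basis_axiomsP (E : finType) (BB : {set {set E}}) :
  reflect (BB != set0 /\ forall A B x, A \in BB -> B \in BB -> x \in A :\: B ->
             exists2 y, y \in B :\: A & (y |: (A :\ x)) \in BB)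
          (basis_axioms BB).
Proof.
apply: (iffP andP) => -[BB0 H]; split=> //.
  move=> A B x HA HB Hx; move/forall_inP/(_ A HA)/forall_inP/(_ B HB): H.
  by move/forall_inP/(_ x Hx)/exists_inP.
apply/forall_inP=> A HA; apply/forall_inP=> B HB; apply/forall_inP=> x Hx.
by apply/exists_inP; apply: H.
Qed.

Lemma indep_bases_axioms (E : finType) (P : pred {set E}) :
  indep_axioms P -> basis_axioms [set B | maxset P B].
Proof.
case=> P0 Ph Pa; apply/basis_axiomsP; split.
  have [B mB _] := maxset_exists (P := P) P0.
  by apply/set0Pn; exists B; rewrite inE.
have le_max A B : maxset P A -> P B -> #|B| <= #|A|.
  move=> mA PB; case: leqP => // ltAB.
  have [x /setDP[_ xA] Px] := Pa _ _ (maxsetp mA) PB ltAB.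
  by move: xA; rewrite -(maxsetsup mA Px (subsetUr _ _)) setU11.
move=> A B x; rewrite !inE => mA mB /andP[xB xA].
have cA : #|A| = (#|A :\ x|).+1 by rewrite (cardsD1 x) xA.
have ltc : #|A :\ x| < #|B| by rewrite -cA le_max // (maxsetp mA).
have [|y] := Pa (A :\ x) B _ (maxsetp mB) ltc.
  by apply: Ph (maxsetp mA); rewrite subD1set.
rewrite !inE negb_and negbK => /andP[/orP[/eqP->|yA] yB] Py.
  by rewrite yB in xB.
exists y; first by rewrite inE yA.
rewrite inE; apply/maxsetP; split=> // C PC sC.
apply/eqP; rewrite eq_sym eqEcard sC /= cardsU1 !inE (negbTE yA) andbF /=.
by rewrite add1n -cA le_max.
Qed.

Lemma card_bases (E : finType) (M : matroid E) A B :
  A \in bases M -> B \in bases M -> #|A| = #|B|.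
Proof.
case/basis_axiomsP: (basesP M) => _ exch.
move: {2}(#|A :\: B|) (leqnn #|A :\: B|) => n.
elim: n A => [|n IHn] A leAB HA HB.
  have sAB : A \subset B.
    by rewrite -setD_eq0 -cards_eq0; move: leAB; rewrite leqn0.
  suff -> : A = B by [].
  apply/eqP; rewrite eqEsubset sAB /=; apply/subsetP=> x xB.
  apply: contraT => xA.
  have [|y] := exch B A x HB HA; first by rewrite inE xA.
  by rewrite inE => /andP[/negP yB yA]; case: yB; apply: (subsetP sAB).
have [/eqP|[x xAB]] := set_0Vmem (A :\: B).
  by rewrite -cards_eq0 => /eqP c0; apply: IHn => //; rewrite c0.
have [y] := exch _ _ _ HA HB xAB; move: (xAB); rewrite !inE.
case/andP=> xB xA /andP[yA yB] HA'.
rewrite -(IHn _ _ HA' HB).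
  by rewrite cardsU1 !inE (negbTE yA) andbF (cardsD1 x A) xA.
have -> : (y |: A :\ x) :\: B = (A :\: B) :\ x.
  apply/setP=> z; rewrite !inE; case: (z =P y) => [->|_] /=.
    by rewrite yB !andbF.
  by rewrite andbCA.
by move: leAB; rewrite (cardsD1 x (A :\: B)) xAB add1n ltnS.
Qed.

Lemma indepP (E : finType) (M : matroid E) (I : {set E}) :
  reflect (exists2 B, B \in bases M & I \subset B) (indep M I).
Proof. exact: exists_inP. Qed.

Lemma indep_basis (E : finType) (M : matroid E) B : B \in bases M -> indep M B.
Proof. by move=> HB; apply/indepP; exists B. Qed.

Lemma indepS (E : finType) (M : matroid E) (I J : {set E}) :
  I \subset J -> indep M J -> indep M I.
Proof.
by move=> sIJ /indepP[B HB sJB]; apply/indepP; exists B => //; apply: subset_trans sJB.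
Qed.

Lemma indep_augment (E : finType) (M : matroid E) (I J : {set E}) :
  indep M I -> indep M J -> #|I| < #|J| ->
  exists2 x, x \in J :\: I & indep M (x |: I).
Proof.
move=> /indepP[A0 HA0 sA0] /indepP[B HB sJB] ltIJ.
case/basis_axiomsP: (basesP M) => _ exch.
pose Q A := (A \in bases M) && (I \subset A).
have QA0 : Q A0 by rewrite /Q HA0.
case: (arg_maxnP (fun A : {set E} => #|A :&: B|) QA0) => A /andP[HA sIA] maxA.
have sDI : A :\: B \subset I.
  apply/subsetP=> x xAB; apply: contraT => xI.
  have [y yBA HA'] := exch _ _ _ HA HB xAB.
  have /maxA : Q (y |: A :\ x).
    rewrite /Q HA' /= subsetU // subsetD1 sIA xI orbT //.
  move: xAB yBA; rewrite !inE => /andP[xB xA] /andP[yA yB].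
  have -> : (y |: A :\ x) :&: B = y |: (A :&: B).
    apply/setP=> z; rewrite !inE; case: (z =P y) => [->|_] //=.
    case: (z =P x) => [->|_] //=; by rewrite (negbTE xB) andbF.
  by rewrite cardsU1 !inE (negbTE yA) /= add1n => /(leq_trans (ltnSn _)); rewrite ltnn.
have [|/exists_inPn no] := boolP [exists x in J :\: I, x \in A].
  case/exists_inP=> x xJI xA; exists x => //.
  by apply/indepP; exists A => //; rewrite subUset sub1set xA.
have sJI : J :\: I \subset B :\: A.
  apply/subsetP=> x xJI; rewrite inE no //=.
  by apply: (subsetP sJB); case/setDP: xJI.
have sAB : A :\: B \subset I :\: J.
  apply/subsetP=> x xAB; rewrite inE (subsetP sDI) // andbT.
  by apply: contraNN (_ : x \notin B) => [/(subsetP sJB)//|]; case/setDP: xAB.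
have := card_bases HA HB; have := cardsID B A; have := cardsID A B.
rewrite setIC; have := subset_leq_card sJI; have := subset_leq_card sAB.
have := cardsID J I; have := cardsID I J; rewrite setIC; lia.
Qed.

Lemma indep_maxset (E : finType) (M : matroid E) B :
  maxset (indep M) B = (B \in bases M).
Proof.
apply/idP/idP=> [mB|HB].
  by have /indepP[A HA /(maxsetsup mB (indep_basis HA)) <-] := maxsetp mB.
apply/maxsetP; split=> [|C /indepP[A HA sCA] sBC]; first exact: indep_basis.
apply/eqP; rewrite eq_sym eqEcard sBC (card_bases HB HA).
exact: subset_leq_card.
Qed.

Lemma indep_extend (E : finType) (M : matroid E) (I S : {set E}) :
  indep M I -> I \subset S ->
  exists J, [/\ indep M J, I \subset J, J \subset S & #|J| = rank M S].
Proof.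
move=> iI sIS; pose Q J := indep M J && (J \subset S).
have QI : Q I by rewrite /Q iI.
have [J mJ sIJ] := maxset_exists QI; exists J.
case/andP: (maxsetp mJ) => iJ sJS; split=> //; apply/eqP; rewrite eqn_leq.
apply/andP; split.
  have /indepP[B HB sJB] := iJ.
  apply: leq_trans (leq_bigmax_cond _ HB).
  by apply: subset_leq_card; rewrite subsetI sJB.
apply/bigmax_leqP=> B HB; case: leqP => // ltJ.
have iBS : indep M (B :&: S) by apply: indepS (indep_basis HB); apply: subsetIl.
have [x] := indep_augment iJ iBS ltJ; rewrite !inE => /and3P[xJ xB xS] iX.
have QX : Q (x |: J) by rewrite /Q iX subUset sub1set xS.
by move: xJ; rewrite -(maxsetsup mJ QX (subsetUr _ _)) setU11.
Qed.

Lemma leq_rank_indep (E : finType) (M : matroid E) (I S : {set E}) :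
  indep M I -> I \subset S -> #|I| <= rank M S.
Proof.
by move=> iI sIS; have [J [_ sIJ _ <-]] := indep_extend iI sIS; apply: subset_leq_card.
Qed.

Lemma indep0 (E : finType) (M : matroid E) : indep M set0.
Proof.
case/basis_axiomsP: (basesP M) => /set0Pn[B HB] _.
by apply/indepP; exists B; rewrite ?sub0set.
Qed.

Lemma rank_axioms_rank (E : finType) (M : matroid E) : rank_axioms (rank M).
Proof.
split=> [S|S T sST|S T].
- by apply/bigmax_leqP=> B _; rewrite subset_leq_card // subsetIr.
- apply/bigmax_leqP=> B HB; apply: leq_trans (leq_bigmax_cond _ HB).
  by rewrite subset_leq_card // setIS.
have [I [iI _ sI <-]] := indep_extend (indep0 M) (sub0set (S :&: T)).
have sIU : I \subset S :|: T.
  by apply: subset_trans sI _; apply: subset_trans (subsetIl _ _) (subsetUl _ _).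
have [J [iJ sIJ sJ <-]] := indep_extend iI sIU.
have iJI X : indep M (J :&: X) by apply: indepS iJ; apply: subsetIl.
apply: leq_trans (leq_add (leq_rank_indep (iJI S) (subsetIr _ _))
                          (leq_rank_indep (iJI T) (subsetIr _ _))).
rewrite -[X in _ <= X]cardsUI -setIUr -setIIr (setIidPl sJ) leq_add2l subset_leq_card //.
by rewrite subsetI sIJ.
Qed.

Lemma rank_closure (E : finType) (r : {set E} -> nat) (I X : {set E}) :
  rank_axioms r -> (forall x, x \in X -> r (x |: I) <= r I) ->
  r (I :|: X) <= r I.
Proof.
case=> _ r_mono r_sub; move: {2}#|X| (erefl #|X|) => n.
elim: n X => [|n IHn] X cX H.
  by move/eqP: cX; rewrite cards_eq0 => /eqP->; rewrite setU0.
have [X0|[x xX]] := set_0Vmem X; first by rewrite X0 cards0 in cX.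
have IH : r (I :|: X :\ x) <= r I.
  apply: IHn => [|y /setD1P[_ /H//]].
  by move: cX; rewrite (cardsD1 x) xX => -[].
have := r_sub (I :|: X :\ x) (x |: I); have := H x xX.
have := r_mono I ((I :|: X :\ x) :&: (x |: I)).
rewrite subsetI subsetUl subsetUr => /(_ isT).
have -> : (I :|: X :\ x) :|: (x |: I) = I :|: X.
  apply/setP=> y; rewrite !inE; case: (y =P x) => [->|_] /=.
    by rewrite xX !orbT.
  by case: (y \in I); rewrite ?orbF.
lia.
Qed.

Lemma rank_indep_axioms (E : finType) (r : {set E} -> nat) :
  rank_axioms r -> indep_axioms (fun I => r I == #|I|).
Proof.
move=> rax; have [r_le r_mono r_sub] := rax; split.
- by have := r_le set0; rewrite cards0 leqn0.
- move=> I J sIJ /eqP rJ; rewrite eqn_leq r_le /=.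
  have := r_sub I (J :\: I); have := r_le (J :\: I).
  have := cardsID I J; rewrite (setIidPr sIJ).
  have -> : I :|: J :\: I = J.
    by apply/setP=> y; rewrite !inE; case: (boolP (y \in I)) => //= /(subsetP sIJ).
  by rewrite rJ; lia.
- move=> I J /eqP rI /eqP rJ ltIJ; apply/exists_inP; apply: contraLR ltIJ.
  move/exists_inPn => no; rewrite -leqNgt -rI -rJ.
  apply: leq_trans (rank_closure (X := J) rax _); first by rewrite r_mono ?subsetUr.
  move=> x xJ; have [xI|xI] := boolP (x \in I).
    by rewrite (setUidPr _) // sub1set.
  have := no x; rewrite inE xI xJ => /(_ isT).
  by have := r_le (x |: I); rewrite cardsU1 xI rI; lia.
Qed.

Definition matroid_of_indep (E : finType) (P : pred {set E})
    (HP : indep_axioms P) : matroid E :=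
  Matroid (indep_bases_axioms HP).

Definition matroid_of_rank (E : finType) (r : {set E} -> nat)
    (Hr : rank_axioms r) : matroid E :=
  matroid_of_indep (rank_indep_axioms Hr).

Lemma rank_matroid_of_rank (E : finType) (r : {set E} -> nat)
  (Hr : rank_axioms r) S : rank (matroid_of_rank Hr) S = r S.
Proof.
have [r_le r_mono r_sub] := Hr; have [P0 Ph _] := rank_indep_axioms Hr.
apply/eqP; rewrite eqn_leq; apply/andP; split.
  apply/bigmax_leqP=> B; rewrite inE => /maxsetp PB.
  by rewrite -(eqP (Ph _ _ (subsetIl B S) PB)) r_mono ?subsetIr.
pose Q (I : {set E}) := (r I == #|I|) && (I \subset S).
have Q0 : Q set0 by rewrite /Q P0 sub0set.
have [I mI _] := maxset_exists Q0; have /andP[rI sIS] := maxsetp mI.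
have [B mB sIB] := maxset_exists (P := fun I : {set E} => r I == #|I|) rI.
have HB : B \in bases (matroid_of_rank Hr) by rewrite inE.
apply: leq_trans (leq_bigmax_cond _ HB).
apply: (@leq_trans #|I|); last by rewrite subset_leq_card // subsetI sIB.
rewrite -(eqP rI) -{1}(setUidPr sIS); apply: (rank_closure Hr) => x xS.
have [xI|xI] := boolP (x \in I); first by rewrite (setUidPr _) // sub1set.
rewrite leqNgt; apply: contra xI => lt_r.
have Qx : Q (x |: I).
  rewrite /Q subUset sub1set xS sIS !andbT eqn_leq r_le cardsU1 /=.
  by rewrite -(eqP rI); case: (x \notin I); lia.
by rewrite -(maxsetsup mI Qx (subsetUr _ _)) setU11.
Qed.

Lemma eq_rank_matroid (E : finType) (M N : matroid E) : rank M =1 rank N -> M = N.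
Proof.
have indepE (K : matroid E) I : indep K I = (rank K I == #|I|).
  apply/idP/eqP=> [iI|rI].
    apply/eqP; rewrite eqn_leq leq_rank_indep // andbT.
    by case: (rank_axioms_rank K) => ->.
  have [J [iJ _ sJI cJ]] := indep_extend (indep0 K) (sub0set I).
  suff <- : J = I by [].
  by apply/eqP; rewrite eqEcard sJI cJ rI leqnn.
move=> eq_r; apply: val_inj; apply/setP=> B /=; rewrite -!indep_maxset.
by apply: maxset_eq => I; rewrite !indepE eq_r.
Qed.

Lemma pullback_rank_axioms (E1 E2 : finType) (f : E1 -> E2) (N : matroid E2) :
  rank_axioms (fun S => rank N (f @: S)).
Proof.
have [r_le r_mono r_sub] := rank_axioms_rank N; split=> [S|S T sST|S T].
- exact: leq_trans (r_le _) (leq_imset_card _ _).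
- by rewrite r_mono ?imsetS.
- apply: leq_trans (r_sub _ _); rewrite imsetU leq_add2l r_mono //.
  by rewrite subsetI !imsetS ?subsetIl ?subsetIr.
Qed.

Definition pullback (E1 E2 : finType) (f : E1 -> E2) (N : matroid E2) :
    matroid E1 :=
  matroid_of_rank (pullback_rank_axioms f N).

(** A subset [U] of the disjoint union stands for the pair
    [(inl @^-1: U, inr @^-1: U)] of its parts. *)
Lemma graph_rank_axioms (E1 E2 : finType) (f : E1 -> E2) :
  rank_axioms (fun U : {set E1 + E2} =>
    #|(f @: (inl @^-1: U)) :|: (inr @^-1: U)|).
Proof.
have gE (U : {set E1 + E2}) : (f @: (inl @^-1: U)) :|: (inr @^-1: U) =
    (fun z => match z with inl a => f a | inr b => b end) @: U.
  apply/setP=> y; rewrite !inE; apply/orP/imsetP.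
    case=> [/imsetP[x]|yU]; last by exists (inr y).
    by rewrite inE => xU ->; exists (inl x).
  case=> -[x|b] zU -> /=; last by right.
  by left; apply: imset_f; rewrite inE.
split=> [S|S T sST|S T]; rewrite !gE ?leq_imset_card //.
  by rewrite subset_leq_card ?imsetS.
rewrite -[X in _ <= X]cardsUI -imsetU leq_add2l subset_leq_card //.
by rewrite subsetI !imsetS ?subsetIl ?subsetIr.
Qed.

Definition graph_matroid (E1 E2 : finType) (f : E1 -> E2) :
    matroid (E1 + E2)%type :=
  matroid_of_rank (graph_rank_axioms f).

Lemma boolean_basis_axioms (E : finType) : basis_axioms [set [set: E]].
Proof.
apply/basis_axiomsP; split=> [|A B x].
  by apply/set0Pn; exists setT; rewrite set11.
by rewrite !inE => /eqP-> /eqP->; rewrite !inE.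
Qed.

Definition boolean_matroid (E : finType) : matroid E :=
  Matroid (boolean_basis_axioms E).

Lemma direct_sum_basis_axioms (E1 E2 : finType)
    (M : matroid E1) (N : matroid E2) :
  basis_axioms [set U : {set E1 + E2} |
    (inl @^-1: U \in bases M) && (inr @^-1: U \in bases N)].
Proof.
case/basis_axiomsP: (basesP M) => /set0Pn[A1 HA1] exM.
case/basis_axiomsP: (basesP N) => /set0Pn[A2 HA2] exN.
apply/basis_axiomsP; split.
  apply/set0Pn; exists (inl @: A1 :|: inr @: A2); rewrite inE.
  have -> : inl @^-1: (inl @: A1 :|: inr @: A2) = A1.
    apply/setP=> z; rewrite !inE; apply/orP/idP=> [[]/imsetP[y yA []]|zA].
      by move=> ->.
      by [].
    by left; apply: imset_f.
  have -> : inr @^-1: (inl @: A1 :|: inr @: A2) = A2.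
    apply/setP=> z; rewrite !inE; apply/orP/idP=> [[]/imsetP[y yA []]|zA].
      by [].
      by move=> ->.
    by right; apply: imset_f.
  by rewrite HA1.
move=> A B x; rewrite !inE => /andP[A1B A2B] /andP[B1B B2B] /andP[xB xA].
case: x xA xB => x xA xB.
  have [|y] := exM _ _ x A1B B1B; first by rewrite !inE xA xB.
  rewrite !inE => /andP[yA yB] HC; exists (inl y); first by rewrite inE yA.
  have e1 : inl @^-1: (inl y |: A :\ inl x) = y |: (inl @^-1: A) :\ x.
    by apply/setP=> z; rewrite !inE.
  have e2 : inr @^-1: (inl y |: A :\ inl x) = inr @^-1: A.
    by apply/setP=> z; rewrite !inE.
  by rewrite inE e1 e2 HC.
have [|y] := exN _ _ x A2B B2B; first by rewrite !inE xA xB.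
rewrite !inE => /andP[yA yB] HC; exists (inr y); first by rewrite inE yA.
have e1 : inl @^-1: (inr y |: A :\ inr x) = inl @^-1: A.
  by apply/setP=> z; rewrite !inE.
have e2 : inr @^-1: (inr y |: A :\ inr x) = y |: (inr @^-1: A) :\ x.
  by apply/setP=> z; rewrite !inE.
by rewrite inE e1 e2 A1B.
Qed.

Definition direct_sum (E1 E2 : finType) (M : matroid E1) (N : matroid E2) :
    matroid (E1 + E2)%type :=
  Matroid (direct_sum_basis_axioms M N).

Lemma maxset_down (E : finType) (P Q : pred {set E}) :
  (forall S, P S -> exists2 T, Q T & S \subset T) -> (forall S, Q S -> P S) ->
  maxset Q =1 maxset P.
Proof.
move=> PQ QP S; apply/idP/idP=> mS; apply/maxsetP; split.
- exact/QP/maxsetp.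
- move=> T /PQ[U QU sTU] sST; apply/eqP; rewrite eqEsubset sST andbT.
  by rewrite -(maxsetsup mS QU (subset_trans sST sTU)).
- by have [T QT sST] := PQ _ (maxsetp mS); rewrite -(maxsetsup mS (QP _ QT) sST).
- by move=> T /QP PT; apply: maxsetsup mS PT.
Qed.

Lemma delete_right_basis_axioms (E1 E2 : finType) (M : matroid (E1 + E2)%type) :
  basis_axioms
    [set S | maxset [in [set inl @^-1: B | B : {set E1 + E2} in bases M]] S].
Proof.
pose P (S : {set E1}) := indep M (inl @: S).
have inl_inj : injective (@inl E1 E2) by move=> ? ? [].
have axP : indep_axioms P.
  split=> [|I J sIJ|I J PI PJ ltIJ]; rewrite /P.
  - by rewrite imset0 indep0.
  - by apply: indepS; apply: imsetS.
  - have [|x] := indep_augment PI PJ; first by rewrite !card_imset.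
    rewrite inE => /andP[xI /imsetP[y yJ xy]]; rewrite {x}xy in xI *.
    by rewrite mem_imset // in xI; exists y; rewrite ?inE ?xI // imsetU1.
have -> : [set S | maxset [in [set inl @^-1: B | B : {set E1 + E2} in bases M]] S]
          = [set S | maxset P S]; last exact: indep_bases_axioms.
apply/setP=> S; rewrite !inE; apply: maxset_down => {}S.
  case/indepP=> B HB sSB; exists (inl @^-1: B); first exact: imset_f.
  by apply/subsetP=> x xS; rewrite inE (subsetP sSB) // imset_f.
case/imsetP=> B HB ->; apply/indepP; exists B => //.
by apply/subsetP=> _ /imsetP[x xB ->]; rewrite inE in xB.
Qed.

(** The deletion of [X] from [M] has as bases the maximal sets [B :\: X], for [B]
    a basis of [M]; here [X] is the summand [E2], so that [B :\: X] is identified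
    with [inl @^-1: B]. *)
Definition delete_right (E1 E2 : finType) (M : matroid (E1 + E2)%type) :
    matroid E1 :=
  Matroid (delete_right_basis_axioms M).

(** Intersection of matroids.  That the minimal sets [A :&: B] are the bases of a
    matroid follows, by complementation, from the matroid union theorem. *)

Lemma dual_basis_axioms (E : finType) (M : matroid E) :
  basis_axioms [set ~: B | B : {set E} in bases M].
Proof.
have [/set0Pn[B0 HB0] _] := basis_axiomsP _ (basesP M).
apply/basis_axiomsP; split; first by apply/set0Pn; exists (~: B0); apply: imset_f.
move=> _ _ x /imsetP[A HA ->] /imsetP[B HB ->]; rewrite !inE negbK => /andP[xB xA].
have iI : indep M (x |: (A :&: B)).
  by apply: indepS (indep_basis HB); rewrite subUset sub1set xB subsetIr.
have sI : x |: (A :&: B) \subset x |: A by rewrite setUS // subsetIl.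
have [D [iD sID sDA cD]] := indep_extend iI sI.
have cDA : #|D| = #|A|.
  apply/eqP; rewrite eqn_leq {2}cD leq_rank_indep ?indep_basis ?subsetUr //.
  have /indepP[C HC sDC] := iD; rewrite (card_bases HA HC).
  by rewrite andbT subset_leq_card.
have HD : D \in bases M.
  have /indepP[C HC sDC] := iD; suff -> : D = C by [].
  by apply/eqP; rewrite eqEcard sDC (card_bases HC HA) cDA /=.
have xD : x \in D by rewrite (subsetP sID) // setU11.
have /subsetPn[y yA yD] : ~~ (A \subset D).
  apply: contra xA => sAD; suff -> : A = D by [].
  by apply/eqP; rewrite eqEcard sAD cDA /=.
have yB : y \notin B.
  by apply: contra yD => yB; rewrite (subsetP sID) // !inE yA yB orbT.
exists y; first by rewrite !inE yA.
suff -> : y |: ~: A :\ x = ~: D by apply: imset_f.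
have DE : D = x |: A :\ y.
  apply/eqP; rewrite eqEcard; apply/andP; split.
    apply/subsetP=> z zD; have := subsetP sDA _ zD; rewrite !inE.
    by case: (z =P y) => //= zy; rewrite zy (negbTE yD) in zD.
  by rewrite cDA cardsU1 !inE (negbTE xA) andbF (cardsD1 y A) yA.
have neq_yx : (y == x) = false by apply: contraNF xA => /eqP <-.
apply/setP=> z; rewrite DE !inE.
have [->|_] := eqVneq z y; first by rewrite neq_yx.
by rewrite /= negb_or.
Qed.

Definition dual (E : finType) (M : matroid E) : matroid E :=
  Matroid (dual_basis_axioms M).

Lemma union_augment_step (E : finType) (M N : matroid E)
    (I1 I2 J1 J2 : {set E}) :
  indep M I1 -> indep N I2 -> indep M J1 ->
  [disjoint I1 & I2] -> [disjoint J1 & J2] -> #|I1| < #|J1| ->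
  (exists2 x, x \in J1 :\: (I1 :|: I2) & indep M (x |: I1)) \/
  (exists K1 K2, [/\ indep M K1, indep N K2, [disjoint K1 & K2],
     K1 :|: K2 = I1 :|: I2
   & #|K1 :&: J2| + #|K2 :&: J1| < #|I1 :&: J2| + #|I2 :&: J1|]).
Proof.
move=> iI1 iI2 iJ1 dI dJ lt1.
have [x] := indep_augment iI1 iJ1 lt1; rewrite inE => /andP[xI1 xJ1] ix.
have [xI2|xI2] := boolP (x \in I2); last first.
  by left; exists x; rewrite // !inE negb_or xI1 xI2.
right; exists (x |: I1), (I2 :\ x); split=> //.
- by apply: indepS iI2; apply: subD1set.
- rewrite -setI_eq0; apply/eqP/setP=> z; rewrite !inE.
  have [//|_ /=] := eqVneq z x.
  by apply/negP=> /andP[zI]; rewrite (disjointFr dI zI).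
- apply/setP=> z; rewrite !inE; have [->|//] := eqVneq z x.
  by rewrite xI2 orbT.
have -> : (x |: I1) :&: J2 = I1 :&: J2.
  apply/setP=> z; rewrite !inE; have [->|//] := eqVneq z x.
  by rewrite (disjointFr dJ xJ1) !andbF.
have -> : (I2 :\ x) :&: J1 = (I2 :&: J1) :\ x.
  by apply/setP=> z; rewrite !inE andbA.
by rewrite (cardsD1 x (I2 :&: J1)) inE xI2 xJ1 ltn_add2l.
Qed.

Lemma union_augment (E : finType) (M N : matroid E) (I1 I2 J1 J2 : {set E}) :
  indep M I1 -> indep N I2 -> indep M J1 -> indep N J2 ->
  [disjoint I1 & I2] -> [disjoint J1 & J2] ->
  #|I1 :|: I2| < #|J1 :|: J2| ->
  exists x K1 K2, [/\ x \in (J1 :|: J2) :\: (I1 :|: I2),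
                      indep M K1, indep N K2 & x |: (I1 :|: I2) = K1 :|: K2].
Proof.
move=> iI1 iI2 iJ1 iJ2 dI dJ.
have [n] := ubnP (#|I1 :&: J2| + #|I2 :&: J1|).
elim: n I1 I2 iI1 iI2 dI => // n IHn I1 I2 iI1 iI2 dI; rewrite ltnS => le_n ltU.
have [lt1|lt2] : #|I1| < #|J1| \/ #|I2| < #|J2|.
  apply/orP; apply: contraLR ltU; rewrite negb_or -!leqNgt => /andP[le1 le2].
  move: dI dJ; rewrite -!setI_eq0 !cardsU => /eqP-> /eqP->.
  by rewrite cards0 !subn0 leq_add.
- have [[x xJ ix]|[K1 [K2 [iK1 iK2 dK eqU ltK]]]] :=
    union_augment_step iI1 iI2 iJ1 dI dJ lt1.
    exists x, (x |: I1), I2; rewrite setUA; split=> //.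
    by move: xJ; rewrite !inE => /andP[-> ->].
  by rewrite -eqU; apply: IHn; rewrite ?eqU // (leq_trans ltK).
- rewrite disjoint_sym in dI; rewrite disjoint_sym in dJ.
  have [[x xJ ix]|[K2 [K1 [iK2 iK1 dK eqU ltK]]]] :=
    union_augment_step iI2 iI1 iJ2 dI dJ lt2.
    exists x, I1, (x |: I2); rewrite setUCA; split=> //.
    by move: xJ; rewrite !inE orbC => /andP[-> ->]; rewrite orbT.
  have eqU' : K1 :|: K2 = I1 :|: I2 by rewrite setUC eqU setUC.
  rewrite -eqU'; apply: IHn; rewrite ?eqU' // 1?disjoint_sym //.
  by rewrite addnC (leq_trans ltK) // addnC.
Qed.

Lemma union_indep_axioms (E : finType) (M N : matroid E) :
  indep_axioms (fun I : {set E} =>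
    [exists A in bases M, exists B in bases N, I \subset A :|: B]).
Proof.
have unionP (I : {set E}) : reflect
    (exists I1 I2, [/\ indep M I1, indep N I2, [disjoint I1 & I2] & I = I1 :|: I2])
    [exists A in bases M, exists B in bases N, I \subset A :|: B].
  apply: (iffP exists_inP) => [[A HA /exists_inP[B HB sI]]|[I1 [I2 [iM iN _ ->]]]].
    exists (I :&: A), (I :\: A); split.
    - by apply: indepS (indep_basis HA); apply: subsetIr.
    - by apply: indepS (indep_basis HB); rewrite subDset.
    - by rewrite -setI_eq0; apply/eqP/setP=> z; rewrite !inE;
        case: (z \in A); rewrite ?andbF.
    - by rewrite setID.
  have [/indepP[A HA sA] /indepP[B HB sB]] := (iM, iN).
  by exists A => //; apply/exists_inP; exists B; rewrite ?setUSS.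
split=> [|I J sIJ /exists_inP[A HA /exists_inP[B HB sJ]]|I J].
- apply/unionP; exists set0, set0; rewrite !indep0 setU0; split=> //.
  by rewrite -setI_eq0 setI0.
- apply/exists_inP; exists A => //; apply/exists_inP; exists B => //.
  exact: subset_trans sJ.
case/unionP=> I1 [I2 [iI1 iI2 dI ->]] /unionP[J1 [J2 [iJ1 iJ2 dJ ->]]].
move=> lt12.
have [x [K1 [K2 [xJI iK1 iK2 eqK]]]] := union_augment iI1 iI2 iJ1 iJ2 dI dJ lt12.
exists x => //; have [/indepP[A HA sA] /indepP[B HB sB]] := (iK1, iK2).
apply/exists_inP; exists A => //; apply/exists_inP; exists B => //.
by rewrite eqK setUSS.
Qed.

Lemma intersection_basis_axioms (E : finType) (M N : matroid E) :
  basis_axioms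
    [set X | minset [in [set A :&: B | A : {set E} in bases M,
                                       B : {set E} in bases N]] X].
Proof.
have := dual_basis_axioms (matroid_of_indep (union_indep_axioms (dual M) (dual N))).
congr (is_true (basis_axioms _)); apply/setP=> X; rewrite inE minmaxset.
have -> : (X \in [set ~: B | B : {set E} in
             bases (matroid_of_indep (union_indep_axioms (dual M) (dual N)))])
        = (~: X \in bases (matroid_of_indep (union_indep_axioms (dual M) (dual N)))).
  by rewrite -{1}[X]setCK mem_imset //; apply: setC_inj.
rewrite inE; apply/esym; apply: maxset_down => S /=.
  case/exists_inP=> _ /imsetP[A HA ->] /exists_inP[_ /imsetP[B HB ->] sS].
  exists (~: (A :&: B)); last by rewrite setCI.
  by rewrite setCK; apply: imset2_f.
case/imset2P=> A B HA HB eqS; apply/exists_inP; exists (~: A); first exact: imset_f.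
apply/exists_inP; exists (~: B); first exact: imset_f.
by rewrite -setCI -eqS setCK.
Qed.

Definition intersection (E : finType) (M N : matroid E) : matroid E :=
  Matroid (intersection_basis_axioms M N).

Definition pushforward (E1 E2 : finType) (C : matroid (E1 + E2)%type)
    (N : matroid E2) : matroid E1 :=
  delete_right (intersection (direct_sum (boolean_matroid E1) N) C).

(* Main.v *)
Require Import Defs.
From mathcomp Require Import all_boot.

(** Let [g : E1 + E2 -> E2] be [f] on the left summand and the identity on the
    right one.  The rank of [U] in the graph matroid of [f] is [#|g @: U|], so its
    bases are exactly the transversals of [g]: the sets that [g] maps bijectively
    onto [E2] ([bases_graph_matroid]).

    A basis [A] of [boolean_matroid E1 (+) N] consists of all of [E1] and of a
    basis [B'] of [N].  If [T] is a transversal, the member of [T] above a given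
    point [b] of [B'] lies in [A], whether it is in [E1] or is [b] itself; hence
    [g] maps [A :&: T] onto a superset of [B'] ([basis_sub_glue]), and
    [#|A :&: T| >= #|B'|].  This bound is the rank of [N], and it is reached:
    when [f] is injective on [S] with [f @: S] inside a basis [B'], the set
    [S] together with [B' :\: f @: S] has [#|B'|] elements and has the form
    [A :&: T] ([sumset_basis_intersection]).  All bases of a matroid have the same
    size, so the bases of the intersection are precisely the sets [A :&: T] of
    size [rank N], and for those [g @: (A :&: T)] is a basis of [N].

    Consequently the traces on [E1] of the bases of the intersection are the sets
    [S] on which [f] is injective with [f @: S] independent in [N]; these are the
    independent sets of the pullback, and their maximal elements are its bases. *)

Set Implicit Arguments.
Unset Strict Implicit.
Unset Printing Implicit Defensive.

Section DisjointUnion.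

Variables E1 E2 : finType.

Definition glue (f : E1 -> E2) (z : E1 + E2) : E2 :=
  match z with inl a => f a | inr b => b end.

Definition sumset (S : {set E1}) (T : {set E2}) : {set E1 + E2} :=
  [set z | match z with inl a => a \in S | inr b => b \in T end].

Lemma preim_inl_sumset S T : inl @^-1: sumset S T = S.
Proof. by apply/setP=> a; rewrite !inE. Qed.

Lemma preim_inr_sumset S T : inr @^-1: sumset S T = T.
Proof. by apply/setP=> b; rewrite !inE. Qed.

Lemma sumsetI S S' T T' :
  sumset S T :&: sumset S' T' = sumset (S :&: S') (T :&: T').
Proof. by apply/setP=> -[a|b]; rewrite !inE. Qed.

Lemma card_sumset S T : #|sumset S T| = #|S| + #|T|.
Proof.
have -> : sumset S T = inl @: S :|: inr @: T.
  apply/setP=> z; rewrite !inE; apply/idP/orP.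
    by case: z => [a|b] h; [left | right]; apply: imset_f.
  by case=> /imsetP[x xX ->].
rewrite cardsU !card_imset; [|by move=> ? ? []|by move=> ? ? []].
have -> : inl @: S :&: inr @: T = set0 :> {set E1 + E2}.
  by apply/setP=> -[a|b]; rewrite !inE; apply/negbTE/negP=> /andP[/imsetP[? _ ?] /imsetP[]].
by rewrite cards0 subn0.
Qed.

Lemma imset_glue f (U : {set E1 + E2}) :
  glue f @: U = f @: (inl @^-1: U) :|: inr @^-1: U.
Proof.
apply/setP=> y; rewrite !inE; apply/imsetP/orP.
  case=> -[a|b] zU -> /=; last by right.
  by left; apply: imset_f; rewrite inE.
case=> [/imsetP[a]|yU]; last by exists (inr y).
by rewrite inE => aU ->; exists (inl a).
Qed.

Lemma bases_graph_matroid f (T : {set E1 + E2}) :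
  (T \in bases (graph_matroid f))
    = (#|glue f @: T| == #|T|) && (glue f @: T == setT).
Proof.
rewrite inE; apply/idP/andP=> [mT|[/eqP gT /eqP gTT]].
  have := maxsetp mT; rewrite -imset_glue => /eqP gT; rewrite gT eqxx.
  split=> //; rewrite -subTset; apply/subsetP=> y _; apply: contraT => yT.
  (* A point [y] missed by the image could be added to [T] as [inr y]. *)
  have yNT : inr y \notin T by apply: contra yT => /(imset_f (glue f)).
  suff /(maxsetsup mT)/(_ (subsetUr _ _)) e :
      #|f @: (inl @^-1: (inr y |: T)) :|: inr @^-1: (inr y |: T)|
        == #|inr y |: T| by rewrite -e setU11 in yNT.
  by rewrite -imset_glue imsetU1 !cardsU1 yT yNT gT.
apply/maxsetP; split=> [|U /eqP]; rewrite -imset_glue ?gT // => gU sTU.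
apply/eqP; rewrite eq_sym eqEcard sTU -gU -gT gTT.
exact/subset_leq_card/subsetT.
Qed.

Lemma bases_boolean_sum (N : matroid E2) (A : {set E1 + E2}) :
  (A \in bases (direct_sum (boolean_matroid E1) N))
    = (inl @^-1: A == setT) && (inr @^-1: A \in bases N).
Proof. by rewrite !inE. Qed.

(** The point of a transversal above [b \in B'] cannot be lost in the
    intersection: either it lies in [E1], all of which is in [A], or it is [b]. *)
Lemma basis_sub_glue f (N : matroid E2) (A T : {set E1 + E2}) :
  A \in bases (direct_sum (boolean_matroid E1) N) ->
  T \in bases (graph_matroid f) ->
  inr @^-1: A \subset glue f @: (A :&: T).
Proof.
rewrite bases_boolean_sum bases_graph_matroid.
move=> /andP[/eqP Al _] /andP[_ /eqP gT]; apply/subsetP=> b bA.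
have /imsetP[z zT bz] : b \in glue f @: T by rewrite gT inE.
rewrite bz imset_f // inE zT andbT; case: z bz {zT} => [a _|c /= <-].
  by have := in_setT a; rewrite -Al inE.
by rewrite inE in bA.
Qed.

Lemma basis_card_glue f (N : matroid E2) (B : {set E2}) (A T : {set E1 + E2}) :
  B \in bases N -> A \in bases (direct_sum (boolean_matroid E1) N) ->
  T \in bases (graph_matroid f) -> #|B| <= #|A :&: T|.
Proof.
move=> HB HA HT; apply: leq_trans (leq_imset_card (glue f) _).
have := HA; rewrite bases_boolean_sum => /andP[_ HA2].
by rewrite (card_bases HB HA2) subset_leq_card ?(basis_sub_glue HA HT).
Qed.

(** The transversal used here completes [S] by the points of [E2] outside
    [f @: S]; meeting it with [E1] and [B] gives a set of size [#|B|], which is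
    minimal because no smaller size can occur. *)
Lemma sumset_basis_intersection f (N : matroid E2) (S : {set E1}) (B : {set E2}) :
  #|f @: S| = #|S| -> f @: S \subset B -> B \in bases N ->
  sumset S (B :\: f @: S)
    \in bases (intersection (direct_sum (boolean_matroid E1) N) (graph_matroid f)).
Proof.
move=> cS sSB HB; rewrite inE; apply/minsetP; split=> [|X].
  have -> : sumset S (B :\: f @: S) = sumset setT B :&: sumset S (~: (f @: S)).
    by rewrite sumsetI setTI setDE.
  apply: imset2_f.
    by rewrite bases_boolean_sum preim_inl_sumset preim_inr_sumset eqxx.
  rewrite bases_graph_matroid imset_glue preim_inl_sumset preim_inr_sumset.
  by rewrite setUCr eqxx andbT card_sumset -cS cardsC cardsT.
case/imset2P=> A T HA HT ->{X} sX; apply/eqP; rewrite eqEcard sX card_sumset -cS.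
by rewrite cardsD (setIidPr sSB) subnKC ?subset_leq_card // (basis_card_glue HB HA HT).
Qed.

(** The bound [#|B'| <= #|A :&: T|] is attained at every basis of the
    intersection, which forces [g] to map that basis onto [B']. *)
Lemma trace_basis_intersection f (N : matroid E2) (X : {set E1 + E2}) :
  X \in bases (intersection (direct_sum (boolean_matroid E1) N) (graph_matroid f)) ->
  #|f @: (inl @^-1: X)| = #|inl @^-1: X| /\ indep N (f @: (inl @^-1: X)).
Proof.
move=> HX; have := HX; rewrite inE => /minsetp/imset2P[A T HA HT eX].
have := HA; rewrite bases_boolean_sum => /andP[_ HB].
set B := inr @^-1: A in HB.
(* Taking [S := set0] shows that [B] itself is a basis of the intersection. *)
have cX : #|X| = #|B|.
  have := @sumset_basis_intersection f N set0 B.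
  rewrite imset0 !cards0 sub0set setD0 => /(_ erefl isT HB) /(card_bases HX) ->.
  by rewrite card_sumset cards0.
have sB : B \subset glue f @: X by rewrite eX (basis_sub_glue HA HT).
have gX : B = glue f @: X.
  by apply/eqP; rewrite eqEcard sB -cX leq_imset_card.
have injX : {in X &, injective (glue f)} by apply/imset_injP; rewrite -gX cX.
split.
  apply/eqP/imset_injP=> a b; rewrite !inE => aX bX fab.
  by have [] := injX (inl a) (inl b) aX bX fab.
by apply/indepP; exists B; rewrite // gX imset_glue subsetUl.
Qed.

End DisjointUnion.

Lemma indep_rank (E : finType) (M : matroid E) (I : {set E}) :
  indep M I = (rank M I == #|I|).
Proof.
apply/idP/eqP=> [iI|rI].
  apply/eqP; rewrite eqn_leq leq_rank_indep // andbT.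
  by case: (rank_axioms_rank M) => ->.
have [J [iJ _ sJI cJ]] := indep_extend (indep0 M) (sub0set I).
suff <- : J = I by [].
by apply/eqP; rewrite eqEcard sJI cJ rI leqnn.
Qed.

Lemma pullback_indep (E1 E2 : finType) (f : E1 -> E2) (N : matroid E2)
    (S : {set E1}) :
  (rank N (f @: S) == #|S|) = (#|f @: S| == #|S|) && indep N (f @: S).
Proof.
rewrite indep_rank; apply/idP/andP=> [/eqP rS|[/eqP <-]//].
have [r_le _ _] := rank_axioms_rank N.
have cS : #|f @: S| = #|S|.
  by apply/eqP; rewrite eqn_leq leq_imset_card -{1}rS r_le.
by rewrite cS rS eqxx.
Qed.

Theorem theorem3p3 (E1 E2 : finType) (f : E1 -> E2) (N : matroid E2) :
  pushforward (graph_matroid f) N = pullback f N.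
Proof.
apply: val_inj; apply/setP=> S0; rewrite !inE.
apply: maxset_eq => S; rewrite /= pullback_indep.
apply/imsetP/andP=> [[X HX ->]|[/eqP cS /indepP[B HB sSB]]].
  by have [-> ->] := trace_basis_intersection HX.
exists (sumset S (B :\: f @: S)); last by rewrite preim_inl_sumset.
exact: sumset_basis_intersection.
Qed.
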